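(* Let $\Lambda$ be a class of stationary memoryless sources over a countably infinite alphabet, identified with $\mathbb{N}_+$. For $x\in\mathbb{N}_+$ let $\hat p(x)=\sup_{P\in\Lambda}P^1\{x\}$. Then for every positive integer $n$, the minimax regret $R^*(\Lambda^n)$ is finite if and only if the normalized maximum likelihood (Shtarkov) coding probability on $\mathbb{N}_+^n$ is well-defined, and $$R^*(\Lambda^n)<\infty \iff \sum_{x\in\mathbb{N}_+}\hat p(x)<\infty .$$
   Context: Logarithms are in base 2; $\mathbb{N}_+=\{1,2,\dots\}$. A source on a countable alphabet $\mathcal{X}$ is a probability distribution $P$ on $\mathcal{X}^{\mathbb{N}}$ (with the product $\sigma$-algebra); $P^n$ is the law of the first $n$ symbols, and for a class $\Lambda$ of sources, $\Lambda^n=\{P^n: P\in\Lambda\}$. A stationary memoryless source is one whose symbols are i.i.d. Throughout, only sources with finite Shannon entropy $H(X_{1:n})$ are considered. $\mathfrak{M}_1(\mathcal{X}^n)$ is the set of probability distributions on $\mathcal{X}^n$. The minimax regret is $$R^*(\Lambda^n)=\inf_{Q^n\in\mathfrak{M}_1(\mathcal{X}^n)}\ \sup_{\mathbf{x}\in\mathcal{X}^n}\ \sup_{P\in\Lambda}\log\frac{P^n(\mathbf{x})}{Q^n(\mathbf{x})},$$ with the conventions $0/0=0$, $\log 0=-\infty$, $\log(a/0)=+\infty$ for $a>0$. For $\mathbf{x}\in\mathcal{X}^n$, $\hat p(\mathbf{x})=\sup_{P\in\Lambda}P^n(\mathbf{x})$. The normalized maximum likelihood coding probability $Q^n_{\mathrm{NML}}(\mathbf{x})=\hat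 p(\mathbf{x})/\sum_{\mathbf{y}\in\mathcal{X}^n}\hat p(\mathbf{y})$ is well-defined when $\sum_{\mathbf{y}\in\mathcal{X}^n}\hat p(\mathbf{y})<\infty$. *)

(* Defs.v *)
From HB Require Import structures.
From mathcomp Require Import all_boot all_order all_algebra finmap.
From mathcomp Require Import all_classical all_reals all_analysis.

Set Implicit Arguments.
Unset Strict Implicit.
Unset Printing Implicit Defensive.

Import Order.TTheory GRing.Theory Num.Theory.

Local Open Scope classical_set_scope.
Local Open Scope ring_scope.
Local Open Scope ereal_scope.

(** The alphabet N_+ = {1, 2, ...}, with its discrete sigma-algebra. *)
Definition posnat := {x : nat | (0 < x)%N}.
HB.instance Definition _ := Countable.on posnat.
HB.instance Definition _ := isPointed.Build posnat (exist _ 1%N isT).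
HB.instance Definition _ := @isMeasurable.Build default_measure_display
  posnat (@discrete_measurable posnat) (@discrete_measurable0 posnat)
  (@discrete_measurableC posnat) (@discrete_measurableU posnat).

(** The product sigma-algebra on N_+^N is generated by the coordinate maps. *)
Definition coordinate_events : set (set (nat -> posnat)) :=
  \bigcup_i preimage_set_system setT (fun w : nat -> posnat => w i) measurable.

Definition message_space := g_sigma_algebraType coordinate_events.

Section Sources.
Variable R : realType.

Definition source := probability message_space R.

Implicit Types (P : source) (Lambda : set source).

Definition symbol_event (i : nat) (A : set posnat) : set message_space :=
  [set w | A (w i)].

Definition independent_symbols P := forall (J : {fset nat}) (A : nat -> set posnat),
  P (\bigcap_(i in [set` J]) symbol_event i (A i)) =
  \prod_(i <- J) P (symbol_event i (A i)).

Definition identically_distributed_symbols P := forall (i : nat) (A : set posnat),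
  P (symbol_event i A) = P (symbol_event 0 A).

Definition stationary_memoryless P :=
  independent_symbols P /\ identically_distributed_symbols P.

(** [w i] is the symbol X_(i+1), so this is X_(1:n). *)
Definition first_symbols (n : nat) (w : message_space) : n.-tuple posnat :=
  [tuple w i | i < n].

(** The library's sigma-algebra on [n.-tuple posnat] is the product one, which
    is here discrete. *)
Definition law P (n : nat) : set (n.-tuple posnat) -> \bar R :=
  pushforward P (first_symbols n).

(** [lne 0 = -oo] and [lne +oo = +oo]. *)
Definition log2 (x : \bar R) : \bar R := lne x / (ln 2)%:E.

(** [0 * log2 0 = 0 * -oo = 0]. *)
Definition entropy P (n : nat) : \bar R :=
  \esum_(x in [set: n.-tuple posnat]) - (law P [set x] * log2 (law P [set x])).

(** Division on [\bar R] satisfies [0 / 0 = 0] and [a / 0 = +oo] for [0 < a]. *)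
Definition minimax_regret Lambda (n : nat) : \bar R :=
  ereal_inf [set
    ereal_sup [set
      ereal_sup [set log2 (law P [set x] / Q [set x]) | P in Lambda]
    | x in [set: n.-tuple posnat]]
  | Q in [set: probability (n.-tuple posnat) R]].

Definition max_likelihood Lambda (n : nat) (x : n.-tuple posnat) : \bar R :=
  ereal_sup [set law P [set x] | P in Lambda].

Definition max_likelihood1 Lambda (x : posnat) : \bar R :=
  max_likelihood Lambda [tuple x].

Definition shtarkov_sum Lambda (n : nat) : \bar R :=
  \esum_(y in [set: n.-tuple posnat]) max_likelihood Lambda y.

(** Normalized maximum likelihood divides [max_likelihood Lambda x] by
    [shtarkov_sum Lambda n]; this is legitimate when the latter is finite. *)
Definition nml_well_defined Lambda (n : nat) := shtarkov_sum Lambda n < +oo.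

End Sources.

(* Main.v *)
Require Import Defs.
From HB Require Import structures.
From mathcomp Require Import all_boot all_order all_algebra finmap.
From mathcomp Require Import all_classical all_reals all_analysis.
Import Order.TTheory GRing.Theory Num.Theory.
Local Open Scope classical_set_scope.
Local Open Scope ring_scope.
Local Open Scope ereal_scope.

(** Write S_n for the Shtarkov sum, the sum over all words x of length n of the
    maximum likelihood p^(x).  The proof rests on two facts.

    The minimax regret is exactly log2 S_n, whether or not S_n is finite
    ([minimax_regretE]).  If a coding probability Q has regret at most c, then
    P(x) <= 2^c Q(x) for every source P, hence p^(x) <= 2^c Q(x), and summing
    over x gives S_n <= 2^c.  Conversely, when S_n is finite, the normalized
    maximum likelihood Q = p^ / S_n satisfies P / Q <= S_n everywhere.  Since
    S_n >= 1 as soon as there is a source, log2 S_n is nonnegative, so the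
    regret is a finite number exactly when S_n is finite.

    The finiteness of S_n is the same for all n > 0.  The memoryless property
    gives p^(x :: t) <= p^(x) p^(t) ([max_likelihood_cons]), so that
    S_(n+1) <= S_1 S_n, and S_n is finite whenever S_1 is.  In the other
    direction P^1(x) is the marginal of P^(n+1), so that p^(x) is at most the
    sum of p^(x :: t) over all t, and S_1 <= S_(n+1) ([le_shtarkov_sum]). *)

(** * Sums of nonnegative families *)

Lemma esum_cons_tuple (R : realType) (T : choiceType) (n : nat)
    (f : n.+1.-tuple T -> \bar R) : (forall y, 0 <= f y) ->
  \esum_(y in [set: n.+1.-tuple T]) f y =
  \esum_(x in [set: T]) \esum_(t in [set: n.-tuple T]) f (cons_tuple x t).
Proof.
move=> f_ge0.
rewrite (@esum_esum _ _ _ _ (fun=> setT) (fun x t => f (cons_tuple x t)))//.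
apply: (@reindex_esum _ _ _ _ _ (fun k : T * n.-tuple T => cons_tuple k.1 k.2)).
split=> //.
- move=> [x t] [x' t'] _ _ /(congr1 val)/= [-> tt'].
  by congr pair; apply: val_inj.
- move=> y _; exists (thead y, behead_tuple y) => //=.
  by rewrite [RHS]tuple_eta; apply: val_inj.
Qed.

(** Scaling the finite partial sums gives only one inequality; the other one is
    the same inequality for the inverse constant. *)
Lemma esum_mulr (R : realType) (T : choiceType) (A : set T) (c : R)
    (f : T -> \bar R) : (0 <= c)%R -> (forall x, 0 <= f x) ->
  \esum_(x in A) (f x * c%:E) = (\esum_(x in A) f x) * c%:E.
Proof.
have le_mulr (k : R) (g : T -> \bar R) : (0 <= k)%R -> (forall x, 0 <= g x) ->
    \esum_(x in A) (g x * k%:E) <= (\esum_(x in A) g x) * k%:E.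
  move=> k_ge0 g_ge0; apply/ereal_supP => _ [F [finF FA] <-].
  rewrite (eq_fsbigr (fun x => k%:E * g x)); last by move=> x _; rewrite muleC.
  rewrite -ge0_mule_fsumr// muleC lee_wpmul2r ?lee_fin//.
  by apply: ereal_sup_ubound; exists F.
rewrite le_eqVlt => /predU1P[<-|c_gt0] f_ge0.
  by rewrite mule0 esum1// => x _; rewrite mule0.
apply/eqP; rewrite eq_le; apply/andP; split.
  by apply: le_mulr => //; exact: ltW.
rewrite -lee_pdivlMr//.
rewrite (eq_esum (b := fun x => f x * c%:E * (c^-1)%:E)); last first.
  by move=> x _; rewrite -muleA -EFinM divff ?gt_eqF// mule1.
apply: le_mulr => [|x]; first by rewrite invr_ge0 ltW.
by rewrite mule_ge0// lee_fin ltW.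
Qed.

(** * Measures and countable sums *)

(** Countable additivity over the fibers of a map with countably many values.
    Applied to [first_symbols], it describes the law of the first symbols by its
    point masses; applied to the identity, it does so for a measure on a
    countable space whose points are measurable. *)
Lemma measure_preimage_esum d (T : measurableType d) (R : realType)
    (mu : {measure set T -> \bar R}) (U : countType) (f : T -> U) (B : set U) :
  (forall u, measurable (f @^-1` [set u])) ->
  mu (f @^-1` B) = \esum_(u in B) mu (f @^-1` [set u]).
Proof.
move=> mf; have pI : injective (@choice.pickle U) := pcan_inj choice.pickleK.
(* The fibers are numbered by the codes of their values; numbers which are not
   codes get the empty set. *)
pose F k := f @^-1` [set u | choice.pickle u = k].
have FE u : F (choice.pickle u) = f @^-1` [set u].
  apply/seteqP; split => w; rewrite /F /=; last by move=> ->.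
  by move/pI.
have mF k : measurable (F k).
  case: (pselect (exists u : U, choice.pickle u = k)) => [[u <-]|nk].
    by rewrite FE.
  rewrite (_ : F k = set0)//; apply/seteqP; split => // w /= wk.
  by apply: nk; exists (f w).
have -> : f @^-1` B = \bigcup_(k in [set choice.pickle u | u in B]) F k.
  apply/seteqP; split => w /=.
    by move=> Bw; exists (choice.pickle (f w)) => //=; exists (f w).
  by move=> [_ [u Bu <-] /= /pI ->].
rewrite measure_bigcup//; last first.
  by move=> i j _ _ [w [/= <- <-]].
rewrite nneseries_esum//.
rewrite (_ : [set _ | _] = [set choice.pickle u | u in B]); last first.
  by apply/seteqP; split => k /=; rewrite inE.
rewrite esum_image; last by move=> u v _ _ /pI.
by apply: eq_esum => u _; rewrite FE.
Qed.

Section ProbabilityMassFunction.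
Context {d : measure_display} {T : measurableType d} {R : realType}.
Variable p : T -> \bar R.
Hypothesis p_ge0 : forall x, 0 <= p x.
Hypothesis p_sum1 : \esum_(x in [set: T]) p x = 1.

Definition pmf_measure (A : set T) : \bar R := \esum_(x in A) p x.

Let pmf0 : pmf_measure set0 = 0. Proof. exact: esum_set0. Qed.
Let pmf_ge0 A : 0 <= pmf_measure A. Proof. exact: esum_ge0. Qed.
Let pmf_sigma_additive : semi_sigma_additive pmf_measure.
Proof.
move=> F mF tF mUF; rewrite /pmf_measure nneseries_sum_bigcup//.
by apply: is_cvg_ereal_nneg_natsum => k _; exact: pmf_ge0.
Qed.

HB.instance Definition _ := isMeasure.Build _ _ _ pmf_measure
  pmf0 pmf_ge0 pmf_sigma_additive.
HB.instance Definition _ := Measure_isProbability.Build _ _ _ pmf_measure p_sum1.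

(** An unordered sum of nonnegative terms is additive over arbitrary disjoint
    sets, so it restricts to a measure on any sigma-algebra. *)
Lemma probability_of_pmf : exists Q : probability T R, forall x, Q [set x] = p x.
Proof. by exists pmf_measure => x; exact: esum_set1. Qed.
End ProbabilityMassFunction.

(** * The binary logarithm of an extended real *)

Lemma ln2_gt0 (R : realType) : (0 < ln 2 :> R)%R.
Proof. by rewrite ln_gt0// ltr1n. Qed.

Lemma log2_leP (R : realType) (y : \bar R) (c : R) : 0 <= y ->
  (log2 y <= c%:E) = (y <= (2 `^ c)%:E).
Proof.
have ln2_gt0 := ln2_gt0 R.
rewrite /log2 inver gt_eqF//; case: y => [r| |]//=.
- rewrite lee_fin le_eqVlt => /predU1P[<-|r_gt0].
    by rewrite lexx gt0_mulNye ?lte_fin ?invr_gt0// leNye lee_fin powR_ge0.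
  rewrite [(r <= 0)%R]leNgt r_gt0/= -EFinM !lee_fin ler_pdivrMr// -ln_powR.
  by rewrite ler_ln// posrE powR_gt0.
- by move=> _; rewrite gt0_mulye ?lte_fin ?invr_gt0//.
Qed.

Lemma log2_ge0 (R : realType) (y : \bar R) : 1 <= y -> 0 <= log2 y.
Proof.
move=> y_ge1; rewrite /log2 mule_ge0 ?lne_ge0// inve_ge0 lee_fin.
by rewrite ln_ge0// ler1n.
Qed.

Lemma log2y (R : realType) : log2 (+oo : \bar R) = +oo.
Proof.
have ln2_gt0 := ln2_gt0 R.
by rewrite /log2 /= inver gt_eqF// gt0_mulye ?lte_fin ?invr_gt0.
Qed.

Lemma log2_fin_num (R : realType) (r : R) : (0 < r)%R -> log2 r%:E \is a fin_num.
Proof.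
move=> r_gt0; have ln2_gt0 := ln2_gt0 R.
by rewrite /log2 lne_EFin// inver gt_eqF.
Qed.

Lemma log2_lty (R : realType) (y : \bar R) : 1 <= y ->
  (log2 y < +oo) = (y < +oo).
Proof.
case: y => [r| |]//; last by rewrite log2y.
rewrite lee_fin ltry => r_ge1.
by have := log2_fin_num _ _ (lt_le_trans ltr01 r_ge1); rewrite fin_numElt => /andP[].
Qed.

(** * Laws of the first symbols of a source *)

Lemma measurable_symbol_event (i : nat) (A : set posnat) :
  measurable (symbol_event i A).
Proof.
apply: sub_sigma_algebra; exists i => //; exists A => //.
by rewrite setTI.
Qed.

Lemma first_symbols_preimage (n : nat) (x : n.-tuple posnat) :
  first_symbols n @^-1` [set x] =
  \bigcap_(i in [set` [fset k in iota 0 n]%fset])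
    symbol_event i [set nth point x i].
Proof.
apply/seteqP; split => w /=.
- move=> <- i /=; rewrite !inE mem_iota/= => ltin.
  rewrite /symbol_event/=.
  by have := tnth_nth point (first_symbols n w) (Ordinal ltin); rewrite tnth_mktuple.
- move=> wx; apply: eq_from_tnth => i; rewrite tnth_mktuple (tnth_nth point).
  by apply: wx; rewrite /= !inE mem_iota/=.
Qed.

Lemma measurable_first_symbols (n : nat) (x : n.-tuple posnat) :
  measurable (first_symbols n @^-1` [set x]).
Proof.
rewrite first_symbols_preimage; apply: fin_bigcap_measurable => [|i _].
  exact: finite_fset.
exact: measurable_symbol_event.
Qed.

Lemma measurable_tuple1 (n : nat) (x : n.-tuple posnat) : measurable [set x].
Proof.
rewrite (_ : [set x] = \bigcap_(i in [set: 'I_n])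
    (setT `&` (@tnth n posnat) ^~ i @^-1` [set tnth x i])); last first.
  apply/seteqP; split => y /=; first by move=> ->.
  by move=> xy; apply: eq_from_tnth => i; have [] := xy i I.
apply: fin_bigcap_measurable => [|i _]; first exact: finite_finset.
exact: measurable_tnth.
Qed.

Section Laws.
Variables (R : realType) (P : source R).

Lemma law_ge0 n (A : set (n.-tuple posnat)) : 0 <= law P A.
Proof. by rewrite /law /pushforward measure_ge0. Qed.

Lemma esum_law n : \esum_(x in [set: n.-tuple posnat]) law P [set x] = 1.
Proof.
rewrite -(probability_setT P) -(preimage_setT (first_symbols n)).
by rewrite (measure_preimage_esum _ _ _ _ _ _ _ (measurable_first_symbols n)).
Qed.

(** The words that begin with [x] are a partition of the event that the first
    symbol is [x]. *)
Lemma law_marginal n (x : posnat) :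
  law P [set [tuple x]] =
  \esum_(t in [set: n.-tuple posnat]) law P [set cons_tuple x t].
Proof.
rewrite -(esum_image _ (cons_tuple x) (fun y => law P [set y])); last first.
  by move=> s t _ _ /(congr1 val)/= [st]; apply: val_inj.
rewrite -(measure_preimage_esum _ _ _ _ _ _ _ (measurable_first_symbols n.+1)).
rewrite /law /pushforward; congr (P _); apply/seteqP; split => w /=.
  move=> wx; exists [tuple of behead (first_symbols n.+1 w)] => //.
  rewrite [RHS]tuple_eta; apply: val_inj => /=; congr cons.
  by move: wx => /(congr1 (@tnth _ _ ^~ ord0)); rewrite /thead !tnth_mktuple tnth0.
move=> [t _ /(congr1 (@tnth _ _ ^~ ord0))]; rewrite tnth0 tnth_mktuple => xw.
by apply: eq_from_tnth => i; rewrite ord1 tnth_mktuple tnth0.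
Qed.

Lemma law_prod n (x : n.-tuple posnat) : stationary_memoryless P ->
  law P [set x] = \prod_(i < n) P (symbol_event 0 [set tnth x i]).
Proof.
move=> [indep ident]; rewrite /law /pushforward first_symbols_preimage indep.
rewrite (perm_big (iota 0 n))/=; last first.
  by apply: uniq_perm; rewrite ?fset_uniq ?iota_uniq// => k; rewrite inE.
rewrite -[n in iota 0 n]subn0 -/(index_iota 0 n) big_mkord.
by apply: eq_bigr => i _; rewrite ident -tnth_nth.
Qed.

Lemma law_cons n (x : posnat) (t : n.-tuple posnat) : stationary_memoryless P ->
  law P [set cons_tuple x t] = law P [set [tuple x]] * law P [set t].
Proof.
move=> PP; rewrite !law_prod// big_ord_recl big_ord1 tnth0; congr (_ * _).
by apply: eq_bigr => i _; rewrite tnthS.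
Qed.
End Laws.

(** * The minimax regret is the logarithm of the Shtarkov sum *)

Section MaxLikelihood.
Variables (R : realType) (Lambda : set (source R)).
Hypothesis Lambda_nonempty : Lambda !=set0.

Lemma law_le_max_likelihood n (x : n.-tuple posnat) P : Lambda P ->
  law P [set x] <= max_likelihood Lambda x.
Proof. by move=> LP; apply: ereal_sup_ubound; exists P. Qed.

Lemma max_likelihood_ge0 n (x : n.-tuple posnat) : 0 <= max_likelihood Lambda x.
Proof.
have [P LP] := Lambda_nonempty.
exact: le_trans (law_ge0 _ _ _ _) (law_le_max_likelihood _ _ _ LP).
Qed.

Lemma max_likelihood_fin_num n (x : n.-tuple posnat) :
  max_likelihood Lambda x \is a fin_num.
Proof.
rewrite ge0_fin_numE ?max_likelihood_ge0//; apply: le_lt_trans (ltry 1).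
apply/ereal_supP => _ [P LP <-].
by apply: probability_le1; exact: measurable_first_symbols.
Qed.

(** Maximum likelihood dominates the law of any one source, whose total mass
    is 1. *)
Lemma shtarkov_sum_ge1 n : 1 <= shtarkov_sum Lambda n.
Proof.
have [P LP] := Lambda_nonempty.
rewrite -(esum_law R P n); apply: le_esum => x _.
exact: law_le_max_likelihood.
Qed.

(** Regret at most [c] against [Q] means that [2 ^ c] times [Q] dominates the
    maximum likelihood, so the Shtarkov sum is at most [2 ^ c] times the total
    mass of [Q]. *)
Lemma log2_shtarkov_sum_le n : log2 (shtarkov_sum Lambda n) <= minimax_regret Lambda n.
Proof.
have S_ge1 := shtarkov_sum_ge1 n.
apply/ereal_infP => _ [Q _ <-]; set r := ereal_sup _.
suff bound (c : R) : r <= c%:E -> log2 (shtarkov_sum Lambda n) <= c%:E.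
  case: (r) bound => [c| |] bound; [exact: bound|by rewrite leey|].
  (* A regret of -oo would be at most -1, which contradicts 1 <= S_n. *)
  have := le_trans (log2_ge0 _ _ S_ge1) (bound (-1)%R (leNye _)).
  by rewrite lee_fin oppr_ge0 ler10.
move=> rc; rewrite log2_leP ?(le_trans _ S_ge1)//.
have sumQ : \esum_(x in [set: n.-tuple posnat]) Q [set x] = 1.
  rewrite -(probability_setT Q) -(preimage_setT id).
  rewrite (measure_preimage_esum _ _ _ Q _ id)// => x.
  exact: measurable_tuple1.
rewrite -[leRHS]mul1e -sumQ -esum_mulr ?powR_ge0//.
apply: le_esum => x _; apply/ereal_supP => _ [P LP <-].
have : log2 (law P [set x] / Q [set x]) <= c%:E.
  apply: le_trans rc; apply: le_trans (ereal_sup_ubound _); last by exists x.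
  by apply: ereal_sup_ubound; exists P.
rewrite log2_leP; last by rewrite mule_ge0 ?inve_ge0 ?law_ge0.
have : 0 <= Q [set x] by [].
have /fineK <- := fin_num_measure Q _ (measurable_tuple1 n x).
rewrite lee_fin le_eqVlt => /predU1P[<-|q_gt0].
  (* Where [Q] vanishes, a finite ratio forces [P] to vanish as well. *)
  rewrite inve0 mul0e; have := law_ge0 R P n [set x].
  rewrite le_eqVlt => /predU1P[<-//|p_gt0].
  by rewrite gt0_muley.
by rewrite inver gt_eqF// lee_pdivrMr// muleC.
Qed.

(** When the Shtarkov sum is finite, normalized maximum likelihood is a coding
    probability against which no likelihood ratio exceeds that sum. *)
Lemma minimax_regret_le n : minimax_regret Lambda n <= log2 (shtarkov_sum Lambda n).
Proof.
have S_ge1 := shtarkov_sum_ge1 n.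
have [->|S_neqy] := eqVneq (shtarkov_sum Lambda n) +oo.
  by rewrite log2y leey.
have S_fin : shtarkov_sum Lambda n \is a fin_num.
  by rewrite ge0_fin_numE ?ltey// (le_trans _ S_ge1).
have /esym := fineK S_fin; move: (fine _) => s Ss.
move: S_ge1; rewrite Ss lee_fin => s_ge1.
have s_gt0 : (0 < s)%R := lt_le_trans ltr01 s_ge1.
have [||Q QE] := probability_of_pmf
  (fun x : n.-tuple posnat => max_likelihood Lambda x * (s^-1)%:E) _ _.
- by move=> x; rewrite mule_ge0 ?max_likelihood_ge0// lee_fin invr_ge0 ltW.
- rewrite esum_mulr ?invr_ge0 ?ltW//; last exact: max_likelihood_ge0.
  by rewrite -/(shtarkov_sum Lambda n) Ss -EFinM divff ?gt_eqF.
apply: ge_ereal_inf; eexists; first by exists Q.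
apply/ereal_supP => _ [x _ <-]; apply/ereal_supP => _ [P LP <-].
have /fineK <- := log2_fin_num _ _ s_gt0.
rewrite log2_leP; last by rewrite mule_ge0 ?inve_ge0 ?law_ge0.
(* The exponent is log2 s, so it is enough to bound the ratio by s. *)
rewrite (@le_trans _ _ s%:E)//; last first.
  rewrite -log2_leP; last by rewrite lee_fin ltW.
  by rewrite fineK// log2_fin_num.
have p_le := law_le_max_likelihood n x P LP.
have := law_ge0 R P n [set x]; rewrite le_eqVlt => /predU1P[<-|p_gt0].
  by rewrite mul0e lee_fin ltW.
have h_gt0 := lt_le_trans p_gt0 p_le.
move: h_gt0 p_le; rewrite QE -(fineK (max_likelihood_fin_num n x)).
rewrite lte_fin => h_gt0 p_le.
rewrite -EFinM inver gt_eqF ?divr_gt0// lee_pdivrMr ?divr_gt0//.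
by rewrite -EFinM mulrC divfK ?gt_eqF.
Qed.

Lemma minimax_regretE n :
  minimax_regret Lambda n = log2 (shtarkov_sum Lambda n).
Proof.
by apply/eqP; rewrite eq_le minimax_regret_le log2_shtarkov_sum_le.
Qed.

(** * Finiteness of the Shtarkov sum at different lengths *)

Hypothesis Lambda_memoryless : forall P, Lambda P -> stationary_memoryless P.

(** For a single memoryless source this is an equality; the supremum over the
    sources of a product is at most the product of the suprema. *)
Lemma max_likelihood_cons n (x : posnat) (t : n.-tuple posnat) :
  max_likelihood Lambda (cons_tuple x t) <=
  max_likelihood1 Lambda x * max_likelihood Lambda t.
Proof.
apply/ereal_supP => _ [P LP <-].
rewrite law_cons; last exact: Lambda_memoryless.
by rewrite lee_pmul ?law_ge0//; exact: law_le_max_likelihood.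
Qed.

(** Summing [max_likelihood_cons] over all first symbols and all tails bounds the
    sum for length [n.+1] by the product of those for lengths [1] and [n]. *)
Lemma shtarkov_sum_lty n :
  \esum_(x in [set: posnat]) max_likelihood1 Lambda x < +oo ->
  shtarkov_sum Lambda n < +oo.
Proof.
move=> S1_lty; elim: n => [|n IHn].
  rewrite /shtarkov_sum (_ : [set: _] = [set [tuple]]); last first.
    by apply/seteqP; split => // t _; exact: tuple0.
  rewrite esum_set1 ?max_likelihood_ge0// -ge0_fin_numE ?max_likelihood_ge0//.
  exact: max_likelihood_fin_num.
have Sn_fin : shtarkov_sum Lambda n \is a fin_num.
  by rewrite ge0_fin_numE// (le_trans _ (shtarkov_sum_ge1 n)).
rewrite /shtarkov_sum esum_cons_tuple; last exact: max_likelihood_ge0.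
apply: le_lt_trans (_ : (\esum_(x in [set: posnat]) max_likelihood1 Lambda x)
  * shtarkov_sum Lambda n < +oo); last first.
  by rewrite muleC lte_mul_pinfty ?(le_trans _ (shtarkov_sum_ge1 n)).
rewrite -(fineK Sn_fin) -esum_mulr; last 2 first.
- by rewrite fine_ge0// (le_trans _ (shtarkov_sum_ge1 n)).
- by move=> x; exact: max_likelihood_ge0.
apply: le_esum => x _; rewrite fineK//.
have x_fin : max_likelihood1 Lambda x \is a fin_num.
  exact: max_likelihood_fin_num.
rewrite -(fineK x_fin) muleC -esum_mulr; last 2 first.
- by rewrite fine_ge0// max_likelihood_ge0.
- by move=> t; exact: max_likelihood_ge0.
by apply: le_esum => t _; rewrite fineK// muleC; exact: max_likelihood_cons.
Qed.

(** A supremum of sums is at most the sum of the suprema, here for the sum over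
    the tails that produces the first marginal of each source. *)
Lemma le_shtarkov_sum n :
  \esum_(x in [set: posnat]) max_likelihood1 Lambda x <= shtarkov_sum Lambda n.+1.
Proof.
rewrite /shtarkov_sum esum_cons_tuple; last exact: max_likelihood_ge0.
apply: le_esum => x _; apply/ereal_supP => _ [P LP <-].
rewrite (law_marginal _ _ n); apply: le_esum => t _.
exact: law_le_max_likelihood.
Qed.

End MaxLikelihood.

Theorem proposition5 (R : realType) (Lambda : set (source R))
    (Lambda_nonempty : Lambda !=set0)
    (Lambda_memoryless : forall P, Lambda P -> stationary_memoryless P)
    (Lambda_entropy : forall P, Lambda P ->
       forall m : nat, (0 < m)%N -> entropy P m < +oo)
    (n : nat) (n_gt0 : (0 < n)%N) :
  (minimax_regret Lambda n \is a fin_num <-> nml_well_defined Lambda n) /\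
  (minimax_regret Lambda n < +oo <->
     \esum_(x in [set: posnat]) max_likelihood1 Lambda x < +oo).
Proof.
have S_ge1 := shtarkov_sum_ge1 R Lambda Lambda_nonempty n.
rewrite minimax_regretE// ge0_fin_numE ?log2_ge0// /nml_well_defined log2_lty//.
split=> //; split=> [|S1_lty]; last exact: shtarkov_sum_lty.
by case: n n_gt0 {S_ge1} => // n _; apply: le_lt_trans; exact: le_shtarkov_sum.
Qed.
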